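(* Let $n\ge1$, $1\le p,q<\infty$, $0\le\nu\le\frac nq$, and $0<\lambda\le\frac np$. There is no constant $C$ such that $$\|\widehat f\|_{M_q^\nu(\mathbb R^n)}\le C\|f\|_{M_p^\lambda(\mathbb R^n)}$$ for every $f\in M_p^\lambda(\mathbb R^n)\cap L_1(\mathbb R^n)$.
   Context: The Fourier transform of $f\in L_1(\mathbb R^n)$ is $\widehat f(y)=\int_{\mathbb R^n}f(x)e^{-2\pi i(x,y)}\,dx$. For $0<p<\infty$ and $0\le\lambda\le\frac np$, the Morrey space $M_p^\lambda(\mathbb R^n)$ consists of all $f\in L_p^{\mathrm{loc}}(\mathbb R^n)$ with $\|f\|_{M_p^\lambda}=\sup_{r>0}r^{-\lambda}\sup_{x\in\mathbb R^n}\|f\|_{L_p(B_r(x))}<\infty$, where $B_r(x)$ is the ball of radius $r$ centered at $x$. (If $\widehat f\notin M_q^\nu$, the left-hand side is understood to be $+\infty$.) *)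

(* Defs.v *)
From HB Require Import structures.
From mathcomp Require Import all_boot all_order all_algebra.
From mathcomp Require Import all_classical all_reals all_analysis.
From mathcomp Require Import complex.

Set Implicit Arguments.
Unset Strict Implicit.
Unset Printing Implicit Defensive.

Import Order.TTheory GRing.Theory Num.Theory.
Import numFieldNormedType.Exports.

Local Open Scope classical_set_scope.
Local Open Scope ring_scope.

(* R^n carries the sigma-algebra generated by the coordinates, i.e. the Borel
   sets.  Every Lebesgue measurable function agrees almost everywhere with a
   Borel one, so considering Borel functions only is no restriction. *)
Notation Rn R n := (n.-tuple (measurableTypeR R)).

Section lebesgue_Rn.
Context {R : realType}.

Definition cons_pair (n : nat) (z : measurableTypeR R * Rn R n) : Rn R n.+1 :=
  [the Rn R n.+1 of z.1 :: z.2].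

Lemma measurable_cons_pair n : measurable_fun setT (@cons_pair n).
Proof.
by apply: measurable_cons; [exact: measurable_fst|exact: measurable_snd].
Qed.

Lemma cons_pairK n (z : measurableTypeR R * Rn R n) :
  (thead (cons_pair z), [tuple of behead (cons_pair z)]) = z.
Proof. by case: z => a b; congr pair; exact: val_inj. Qed.

Section lebesgue_cons.
Context (n : nat) (mu : {sigma_finite_measure set (Rn R n) -> \bar R}).
Local Open Scope ereal_scope.

Definition lebesgue_cons : set (Rn R n.+1) -> \bar R :=
  pushforward (@lebesgue_measure R \x mu) (@cons_pair n).

Let mpre (A : set (Rn R n.+1)) : measurable A ->
  measurable (@cons_pair n @^-1` A).
Proof.
by move=> mA; rewrite -[X in measurable X]setTI; exact: measurable_cons_pair.
Qed.

Let lebesgue_cons0 : lebesgue_cons set0 = 0.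
Proof. by rewrite /lebesgue_cons /pushforward preimage_set0 measure0. Qed.

Let lebesgue_cons_ge0 A : 0 <= lebesgue_cons A.
Proof. by rewrite /lebesgue_cons /pushforward; apply: measure_ge0. Qed.

Let lebesgue_cons_sigma_additive : semi_sigma_additive lebesgue_cons.
Proof.
move=> F mF tF mUF; rewrite /lebesgue_cons /pushforward preimage_bigcup.
apply: measure_semi_sigma_additive.
- by move=> i; exact: mpre.
- apply/trivIsetP => /= i j _ _ ij; rewrite -preimage_setI.
  by move/trivIsetP : tF => /(_ _ _ _ _ ij) ->//; rewrite preimage_set0.
- by rewrite -preimage_bigcup; exact: mpre.
Qed.

HB.instance Definition _ := isMeasure.Build _ _ _ lebesgue_cons
  lebesgue_cons0 lebesgue_cons_ge0 lebesgue_cons_sigma_additive.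

Let sigma_finite_lebesgue_cons : sigma_finite setT lebesgue_cons.
Proof.
have /sigma_finiteP[F [TF ndF Foo]] := sigma_finiteT (@lebesgue_measure R).
have /sigma_finiteP[G [TG ndG Goo]] := sigma_finiteT mu.
exists (fun i => (fun x : Rn R n.+1 => (thead x, [tuple of behead x])) @^-1`
                 (F i `*` G i)) => [|i].
  apply/seteqP; split=> // x _.
  have [i _ Fi] : (\bigcup_i F i) (thead x) by rewrite -TF.
  have [j _ Gj] : (\bigcup_i G i) [tuple of behead x] by rewrite -TG.
  exists (maxn i j) => //; split=> /=.
    by move: Fi; exact/subsetPset/ndF/leq_maxl.
  by move: Gj; exact/subsetPset/ndG/leq_maxr.
have [mFi Fioo] := Foo i; have [mGi Gioo] := Goo i.
have mdec : measurable_fun setT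
    (fun x : Rn R n.+1 => (thead x, [tuple of behead x]) : _ * Rn R n).
  apply/measurable_fun_pair; last exact: measurable_behead.
  exact: measurable_tnth.
split.
  by rewrite -[X in measurable X]setTI; apply: mdec => //; exact: measurableX.
rewrite /lebesgue_cons /pushforward (_ : _ @^-1` _ = F i `*` G i); last first.
  by apply/funext => z; exact: (congr1 (F i `*` G i) (cons_pairK z)).
by rewrite product_measure1E// lte_mul_pinfty// ge0_fin_numE.
Qed.

HB.instance Definition _ := Measure_isSigmaFinite.Build _ _ _ lebesgue_cons
  sigma_finite_lebesgue_cons.

End lebesgue_cons.

Fixpoint lebesgue_Rn (n : nat) :
    {sigma_finite_measure set (Rn R n) -> \bar R} :=
  match n with
  | 0 => \d_ ([tuple] : Rn R 0)
  | m.+1 => lebesgue_cons (lebesgue_Rn m)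
  end.

Lemma lebesgue_Rn_box (n : nat) (A : 'I_n -> set (measurableTypeR R)) :
  (forall i, measurable (A i)) ->
  lebesgue_Rn n [set x : Rn R n | forall i, A i (tnth x i)] =
    (\prod_(i < n) lebesgue_measure (A i))%E.
Proof.
elim: n A => [|n IH] A mA.
  by rewrite big_ord0 /= diracE mem_set// => -[].
rewrite big_ord_recl -IH; last by move=> i; exact: mA.
rewrite -product_measure1E; last 2 first.
- exact: mA.
- rewrite (_ : [set x | _] = \bigcap_(i in [set: 'I_n])
      ((fun x : Rn R n => tnth x i) @^-1` A (lift ord0 i))); last first.
    by apply/seteqP; split=> x /= Ax => [i _|i]; exact: Ax.
  apply: fin_bigcap_measurable => [|i _]; first exact: finite_finset.
  by rewrite -[X in measurable X]setTI; exact: measurable_tnth.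
rewrite /= /lebesgue_cons /pushforward; congr (product_measure1 _ _ _).
apply/seteqP; split=> -[a b] /=.
  move=> Aab; split; first by have := Aab ord0; rewrite tnth0.
  by move=> i; have := Aab (lift ord0 i); rewrite tnthS.
by move=> [Aa Ab] i; case: (unliftP ord0 i) => [j ->|->]; rewrite ?tnthS ?tnth0.
Qed.

End lebesgue_Rn.

Section fourier_morrey.
Local Open Scope complex_scope.
Context {R : realType} {n : nat}.
Implicit Types (f : Rn R n -> R[i]) (x y : Rn R n) (p r lambda : R).

Definition dotp x y : R := \sum_(i < n) tnth x i * tnth y i.

Definition euclid_ball x r : set (Rn R n) :=
  [set y | Num.sqrt (\sum_(i < n) (tnth y i - tnth x i) ^+ 2) < r].

Definition cmeasurable f :=
  measurable_fun [set: Rn R n] (fun x => complex.Re (f x)) /\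
  measurable_fun [set: Rn R n] (fun x => complex.Im (f x)).

Definition L1 f :=
  cmeasurable f /\
  (lebesgue_Rn n).-integrable setT (fun x => (Normc.normc (f x))%:E).

Definition expi (t : R) : R[i] := cos t +i* sin t.

(* Rintegral is the real-valued Lebesgue integral; this is the usual complex
   integral whenever f is integrable. *)
Definition cintegral f : R[i] :=
  Rintegral (lebesgue_Rn n) setT (fun x => complex.Re (f x)) +i*
  Rintegral (lebesgue_Rn n) setT (fun x => complex.Im (f x)).

Definition fourier f y : R[i] :=
  cintegral (fun x => f x * expi (- (2 * pi * dotp x y))).

Definition Lp_norm p (B : set (Rn R n)) f : \bar R :=
  ('N[lebesgue_Rn n]_(p%:E)[(fun x => (Normc.normc (f x))%:E) \_ B])%E.

(* Every ball lies in a compact set and every compact set lies in a ball, so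
   the balls may replace the compact sets in the definition of L_p^loc. *)
Definition Lp_loc p f :=
  cmeasurable f /\ forall x r, 0 < r -> (Lp_norm p (euclid_ball x r) f < +oo)%E.

(* The value +oo is allowed: for a measurable f that is locally bounded, as every
   Fourier transform of an integrable function is, it is taken exactly when f
   does not belong to the Morrey space. *)
Definition morrey_norm p lambda f : \bar R :=
  ereal_sup [set ((r `^ (- lambda))%:E *
      ereal_sup [set Lp_norm p (euclid_ball x r) f | x in [set: Rn R n]])%E
    | r in [set r : R | 0 < r]].

Definition morrey p lambda f :=
  Lp_loc p f /\ (morrey_norm p lambda f < +oo)%E.

End fourier_morrey.

(* Main.v *)
(* Rudin-Shapiro pairs with lacunary translations.  Put f_0 = g_0 = 1_D for a
   small cube D and
     f_{k+1} = f_k + tau_k g_k,   g_{k+1} = f_k - tau_k g_k,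
   where tau_k translates by a vector of enormous length.  Both functions are
   bounded by the indicator of a union E_k of 2^k translates of D which is so
   sparse that |E_k cap B_r(x)| <= 2^n r^(lambda p) for all x and r, so their
   Morrey norms are bounded independently of k.  The Fourier transform turns
   tau_k into a unimodular factor, and the parallelogram law gives
     |f_k^|^2 + |g_k^|^2 = 2^(k+1) |1_D^|^2   pointwise.
   Since |1_D^| is bounded below on the unit ball, f_k^ and g_k^ cannot both
   stay bounded in L_q of that ball. *)

Require Import Defs.
From mathcomp Require Import all_boot all_order all_algebra.
From mathcomp Require Import all_classical all_reals all_analysis.
From mathcomp Require Import measurable_realfun complex.
From mathcomp Require Import ring lra.

Set Implicit Arguments.
Unset Strict Implicit.
Unset Printing Implicit Defensive.

Import Order.TTheory GRing.Theory Num.Theory.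
Import numFieldNormedType.Exports.

Local Open Scope ring_scope.
Local Open Scope complex_scope.

(* The measure structure on a pushforward depends on a proof of measurability of
   the map, which unification cannot supply. *)
Local Notation pushforward_measure :=
  measure_function_pushforward__canonical__measure_function_Measure.

(** * Translation invariance of Lebesgue measure on R^n *)

Section translate.
Context {R : realType}.
Local Open Scope classical_set_scope.

Definition translate n (v x : Rn R n) : Rn R n :=
  [tuple tnth x i + tnth v i | i < n].

Lemma measurable_translate n (v : Rn R n) : measurable_fun setT (translate v).
Proof.
apply/measurable_fun_tnthP => i.
rewrite (_ : _ \o _ = (fun x : Rn R n => tnth x i + tnth v i)).
  by apply: measurable_funD => //; exact: measurable_tnth.
by apply/funext => x /=; rewrite tnth_mktuple.
Qed.

Lemma translate_cons n (v : Rn R n.+1) (z : measurableTypeR R * Rn R n) :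
  translate v (cons_pair z) =
  cons_pair (z.1 + thead v, translate [tuple of behead v] z.2).
Proof.
apply: eq_from_tnth => i; rewrite tnth_mktuple.
case: (unliftP ord0 i) => [j ->|->].
  rewrite !tnthS tnth_mktuple; congr (_ + _).
  by rewrite {1}(tuple_eta v) tnthS.
by rewrite !tnth0.
Qed.

(** The pushforward under a shift gives every half-open interval its length, so uniqueness of
    Lebesgue measure applies. *)
Lemma lebesgue_measure_shift (c : R) (A : set (measurableTypeR R)) :
  measurable A -> lebesgue_measure ((fun t => t + c) @^-1` A) =
  lebesgue_measure A.
Proof.
move=> mA; have mc : measurable_fun setT
    (fun t : measurableTypeR R => t + c : measurableTypeR R).
  exact: measurable_funD.
apply/esym.
have := @lebesgue_measure_unique _
  (pushforward_measure lebesgue_measure mc) _ A mA.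
apply=> {A mA}.
move=> _ [[a b] _ <-] /=; rewrite /pushforward.
rewrite (_ : _ @^-1` _ = `]a - c, b - c]); last first.
  by apply/seteqP; split=> x /=; rewrite !in_itv /= ltrBlDr lerBrDr.
rewrite !lebesgue_measure_itv /= !lte_fin ltrD2r.
by rewrite -!EFinB opprB addrA subrK.
Qed.

(** Induction on the dimension: a translation is the product [phi] of a shift of the first
    coordinate and a translation of the others. The pushforward by [phi] agrees with the product
    measure on rectangles, hence everywhere. In dimension 0 there is only one point. *)
Lemma lebesgue_Rn_translate n (v : Rn R n) (A : set (Rn R n)) :
  measurable A -> lebesgue_Rn n (translate v @^-1` A) = lebesgue_Rn n A.
Proof.
elim: n v A => [|n IH] v A mA.
  rewrite (_ : translate v @^-1` A = A)//.
  by apply/funext => x /=; rewrite [translate v x]tuple0 [x]tuple0.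
rewrite /= /lebesgue_cons.
set mu := (lebesgue_measure \x _)%E.
pose phi (z : measurableTypeR R * Rn R n) :=
  (z.1 + thead v, translate [tuple of behead v] z.2) :
  measurableTypeR R * Rn R n.
have mshift : measurable_fun setT
    (fun t : measurableTypeR R => t + thead v : measurableTypeR R).
  exact: measurable_funD.
have mphi : measurable_fun setT phi.
  apply/measurable_fun_pair.
    by apply: measurable_funD => //; exact: measurable_fst.
  by apply: measurableT_comp;
    [exact: measurable_translate|exact: measurable_snd].
have mcA : measurable (@cons_pair R n @^-1` A).
  by rewrite -[X in measurable X]setTI; exact: measurable_cons_pair.
transitivity (pushforward mu phi (@cons_pair R n @^-1` A)).
  rewrite /pushforward; congr (mu _); apply/funext => z /=.
  by rewrite -translate_cons.
have := @product_measure_unique _ _ _ _ _ lebesgue_measure (lebesgue_Rn n)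
  (pushforward_measure mu mphi) _ _ mcA.
move=> H; apply/esym/H => {A mA mcA H}.
move=> B C mB mC; rewrite /pushforward -[LHS]/(mu (phi @^-1` (B `*` C))).
rewrite (_ : phi @^-1` _ = ((fun t => t + thead v) @^-1` B) `*`
  (translate [tuple of behead v] @^-1` C))//.
rewrite /mu product_measure1E; first 1 last.
- by rewrite -[X in measurable X]setTI; apply: mshift.
- by rewrite -[X in measurable X]setTI; apply: measurable_translate.
- by congr (_ * _)%E; [exact: lebesgue_measure_shift|exact: IH].
Qed.

End translate.

(** * Translation invariance of integrals *)

Section integral_translate.
Context {R : realType} {n : nat}.
Local Open Scope classical_set_scope.
Local Notation mu := (@lebesgue_Rn R n).
Implicit Types (v x y : Rn R n).

Lemma translateK v : cancel (translate (map_tuple -%R v)) (translate v).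
Proof.
by move=> x; apply: eq_from_tnth => i; rewrite !tnth_mktuple tnth_map subrK.
Qed.

(** For nonnegative functions this is the change of variables through the pushforward; the general
    case follows by positive and negative parts. *)
Lemma integral_translate v (F : Rn R n -> \bar R) : measurable_fun setT F ->
  (\int[mu]_x F (translate v x) = \int[mu]_x F x)%E.
Proof.
have ge0 (G : Rn R n -> \bar R) : measurable_fun setT G ->
    (forall x, (0 <= G x)%E) ->
    (\int[mu]_x G (translate v x) = \int[mu]_x G x)%E.
  move=> mG G0.
  have := ge0_integral_pushforward (measurable_translate v) mu measurableT mG.
  rewrite preimage_setT => /(_ (fun x _ => G0 x)) <-.
  apply: (eq_measure_integral mu
    (m1 := pushforward_measure mu (measurable_translate v))) => A mA _.
  exact: (lebesgue_Rn_translate v mA).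
move=> mF; rewrite integralE [RHS]integralE.
have Ep := ge0 (F^\+)%E (measurable_funepos mF) (funepos_ge0 F).
have En := ge0 (F^\-)%E (measurable_funeneg mF) (funeneg_ge0 F).
congr (_ - _)%E; [rewrite -Ep|rewrite -En]; apply: eq_integral => x _.
  by rewrite !funeposE.
by rewrite !funenegE.
Qed.

Lemma integrable_translate v (F : Rn R n -> \bar R) :
  mu.-integrable setT F -> mu.-integrable setT (F \o translate v).
Proof.
move=> /integrableP[mF Foo]; apply/integrableP; split.
  by apply: measurableT_comp => //; exact: measurable_translate.
rewrite /= (integral_translate v (F := fun x => `|F x|%E))//.
exact: measurableT_comp.
Qed.

End integral_translate.

(** Tonelli makes the integrals of the positive and negative parts measurable in the parameter, and
    [fine] is measurable on the extended line. It yields the measurability of Fourier transforms. *)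
Lemma measurable_Rintegral d1 d2 (T1 : measurableType d1)
    (T2 : measurableType d2) (R : realType)
    (m : {sigma_finite_measure set T2 -> \bar R}) (F : T1 * T2 -> R) :
  measurable_fun setT F -> measurable_fun setT (fun x => \int[m]_y F (x, y)).
Proof.
move=> mF; have mEF : measurable_fun setT (EFin \o F) by exact/measurable_EFinP.
rewrite (_ : (fun x => _) = (fine \o (fun x =>
    (\int[m]_y (EFin \o F)^\+ (x, y) - \int[m]_y (EFin \o F)^\- (x, y))%E))).
  apply: measurableT_comp; first exact: fine_measurable.
  apply: emeasurable_funB.
    apply: (measurable_fun_fubini_tonelli_F (m2 := m)).
      exact: measurable_funepos.
    by move=> z; exact: funepos_ge0.
  apply: (measurable_fun_fubini_tonelli_F (m2 := m)).
    exact: measurable_funeneg.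
  by move=> z; exact: funeneg_ge0.
apply/funext => x; rewrite /Rintegral/= integralE.
by congr (fine (_ - _)%E); apply: eq_integral => y _;
  rewrite ?funeposE ?funenegE.
Qed.

(** * Real and imaginary parts of the Fourier transform of a real function *)

Section fourier_real.
Context {R : realType} {n : nat}.
Local Open Scope classical_set_scope.
Local Notation mu := (@lebesgue_Rn R n).
Implicit Types (f g : Rn R n -> R) (v x y : Rn R n).

Definition phase x y : R := - (2 * pi * dotp x y).

Definition fcos f y : R := \int[mu]_x (f x * cos (phase x y)).

Definition fsin f y : R := \int[mu]_x (f x * sin (phase x y)).

Lemma fourier_real f y :
  fourier (fun x => (f x)%:C) y = fcos f y +i* fsin f y.
Proof.
by congr (_ +i* _); apply: eq_Rintegral => x _ /=; rewrite mul0r ?subr0 ?addr0.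
Qed.

Lemma phase_translate v x y : phase (translate v x) y = phase x y + phase v y.
Proof.
rewrite /phase -opprD -mulrDr /dotp -big_split/=; congr (- (_ * _)).
by apply: eq_bigr => i _; rewrite tnth_mktuple mulrDl.
Qed.

Lemma measurable_phase :
  measurable_fun setT (fun z : Rn R n * Rn R n => phase z.2 z.1).
Proof.
apply: measurableT_comp => //; apply: measurable_funM => //.
apply: measurable_sum => i; apply: measurable_funM.
  exact: (measurableT_comp (measurable_tnth i) measurable_snd).
exact: (measurableT_comp (measurable_tnth i) measurable_fst).
Qed.

Let measurable_cos_phase : measurable_fun setT
  (fun z : Rn R n * Rn R n => cos (phase z.2 z.1)).
Proof.
apply: measurableT_comp measurable_phase.
by apply: continuous_measurable_fun; exact: continuous_cos.
Qed.

Let measurable_sin_phase : measurable_fun setT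
  (fun z : Rn R n * Rn R n => sin (phase z.2 z.1)).
Proof.
apply: measurableT_comp measurable_phase.
by apply: continuous_measurable_fun; exact: continuous_sin.
Qed.

Lemma measurable_fcos f : measurable_fun setT f -> measurable_fun setT (fcos f).
Proof.
move=> mf; apply: (measurable_Rintegral (lebesgue_Rn n)
  (F := fun z : Rn R n * Rn R n => f z.2 * cos (phase z.2 z.1))).
apply: measurable_funM => //.
exact: (measurableT_comp mf measurable_snd).
Qed.

Lemma measurable_fsin f : measurable_fun setT f -> measurable_fun setT (fsin f).
Proof.
move=> mf; apply: (measurable_Rintegral (lebesgue_Rn n)
  (F := fun z : Rn R n * Rn R n => f z.2 * sin (phase z.2 z.1))).
apply: measurable_funM => //.
exact: (measurableT_comp mf measurable_snd).
Qed.

Let measurable_cosr y : measurable_fun setT (fun x => cos (phase x y)).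
Proof. exact: (measurableT_comp measurable_cos_phase (measurable_pair1 y)). Qed.

Let measurable_sinr y : measurable_fun setT (fun x => sin (phase x y)).
Proof. exact: (measurableT_comp measurable_sin_phase (measurable_pair1 y)). Qed.

Lemma integrable_mul_bounded f (h : Rn R n -> R) :
  mu.-integrable setT (EFin \o f) -> measurable_fun setT h ->
  (forall x, `|h x| <= 1) ->
  mu.-integrable setT (EFin \o (fun x => f x * h x)).
Proof.
move=> fi mh h1; apply: (le_integrable _ _ _ fi) => //.
  apply/measurable_EFinP/measurable_funM => //.
  by have /measurable_EFinP := measurable_int _ fi.
by move=> x _ /=; rewrite lee_fin normrM ler_piMr.
Qed.

Let cos_norm1 (t : R) : `|cos t| <= 1.
Proof. by rewrite ler_norml cos_geN1 cos_le1. Qed.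

Let sin_norm1 (t : R) : `|sin t| <= 1.
Proof. by rewrite ler_norml sin_geN1 sin_le1. Qed.

Lemma integrable_mul_cos f y : mu.-integrable setT (EFin \o f) ->
  mu.-integrable setT (EFin \o (fun x => f x * cos (phase x y))).
Proof. by move=> fi; apply: integrable_mul_bounded. Qed.

Lemma integrable_mul_sin f y : mu.-integrable setT (EFin \o f) ->
  mu.-integrable setT (EFin \o (fun x => f x * sin (phase x y))).
Proof. by move=> fi; apply: integrable_mul_bounded. Qed.

Lemma Rintegral_translate v f : measurable_fun setT f ->
  \int[mu]_x f (translate v x) = \int[mu]_x f x.
Proof.
move=> mf; congr fine; apply: (integral_translate v (F := EFin \o f)).
exact/measurable_EFinP.
Qed.

(** The function on the left is [f (x - v)]. Replacing [x] by [x + v] adds [phase v y] to the phase,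
    and the addition formula separates it. Together with [fsin_translate], this rotates the pair
    ([fcos f y], [fsin f y]) by the angle [phase v y]. *)
Lemma fcos_translate v f y : mu.-integrable setT (EFin \o f) ->
  fcos (f \o translate (map_tuple -%R v)) y =
  fcos f y * cos (phase v y) - fsin f y * sin (phase v y).
Proof.
move=> fi; have /measurable_EFinP mf := measurable_int _ fi.
rewrite -!RintegralZr//; [|exact: integrable_mul_sin|exact: integrable_mul_cos].
rewrite -RintegralB//; last 2 first.
- by apply: integrable_mul_bounded => //; exact: integrable_mul_cos.
- by apply: integrable_mul_bounded => //; exact: integrable_mul_sin.
rewrite -(Rintegral_translate (map_tuple -%R v)); last first.
  by apply: measurable_funB; apply: measurable_funM => //;
    exact: measurable_funM.
apply: eq_Rintegral => x _ /=.
by rewrite -{2}(translateK v x) phase_translate cosD mulrBr !mulrA.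
Qed.

Lemma fsin_translate v f y : mu.-integrable setT (EFin \o f) ->
  fsin (f \o translate (map_tuple -%R v)) y =
  fsin f y * cos (phase v y) + fcos f y * sin (phase v y).
Proof.
move=> fi; have /measurable_EFinP mf := measurable_int _ fi.
rewrite -!RintegralZr//; [|exact: integrable_mul_cos|exact: integrable_mul_sin].
rewrite -RintegralD//; last 2 first.
- by apply: integrable_mul_bounded => //; exact: integrable_mul_sin.
- by apply: integrable_mul_bounded => //; exact: integrable_mul_cos.
rewrite -(Rintegral_translate (map_tuple -%R v)); last first.
  by apply: measurable_funD; apply: measurable_funM => //;
    exact: measurable_funM.
apply: eq_Rintegral => x _ /=.
by rewrite -{2}(translateK v x) phase_translate sinD mulrDr !mulrA.
Qed.

(** Translating [g] only rotates the value of its transform at [y] and keeps its modulus; what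
    remains is the parallelogram law in the plane. *)
Lemma fourier_parallelogram v f g y :
  mu.-integrable setT (EFin \o f) -> mu.-integrable setT (EFin \o g) ->
  let h := g \o translate (map_tuple -%R v) in
  (fcos (f \+ h) y ^+ 2 + fsin (f \+ h) y ^+ 2) +
  (fcos (f \- h) y ^+ 2 + fsin (f \- h) y ^+ 2) =
  ((fcos f y ^+ 2 + fsin f y ^+ 2) + (fcos g y ^+ 2 + fsin g y ^+ 2)) *+ 2.
Proof.
move=> fi gi h.
have hi : mu.-integrable setT (EFin \o h) by exact: integrable_translate gi.
have cD : fcos (f \+ h) y = fcos f y + fcos h y.
  rewrite -RintegralD//; [|exact: integrable_mul_cos|exact: integrable_mul_cos].
  by apply: eq_Rintegral => x _; rewrite mulrDl.
have sD : fsin (f \+ h) y = fsin f y + fsin h y.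
  rewrite -RintegralD//; [|exact: integrable_mul_sin|exact: integrable_mul_sin].
  by apply: eq_Rintegral => x _; rewrite mulrDl.
have cB : fcos (f \- h) y = fcos f y - fcos h y.
  rewrite -RintegralB//; [|exact: integrable_mul_cos|exact: integrable_mul_cos].
  by apply: eq_Rintegral => x _; rewrite mulrBl.
have sB : fsin (f \- h) y = fsin f y - fsin h y.
  rewrite -RintegralB//; [|exact: integrable_mul_sin|exact: integrable_mul_sin].
  by apply: eq_Rintegral => x _; rewrite mulrBl.
rewrite cD sD cB sB fcos_translate// fsin_translate//.
have := cos2Dsin2 (phase v y).
set c := cos _; set s := sin _ => cs.
(* Inserting the factor [c ^+ 2 + s ^+ 2], which equals 1, turns the goal into a polynomial identity
   in independent variables. *)
suff -> : fcos g y ^+ 2 + fsin g y ^+ 2 =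
   (fcos g y ^+ 2 + fsin g y ^+ 2) * (c ^+ 2 + s ^+ 2) by ring.
by rewrite cs mulr1.
Qed.

End fourier_real.

Lemma integrable_le_indic d (T : measurableType d) (R : realType)
    (m : {measure set T -> \bar R}) (E : set T) (f : T -> R) :
  measurable E -> (m E < +oo)%E -> measurable_fun setT f ->
  (forall x, `|f x| <= \1_E x) -> m.-integrable setT (EFin \o f).
Proof.
move=> mE Eoo mf fE; apply/integrableP; split; first exact/measurable_EFinP.
apply: le_lt_trans Eoo; rewrite -[E in leRHS]setIT -integral_indic//.
apply: ge0_le_integral => //.
- by apply: measurableT_comp => //; exact/measurable_EFinP.
- by apply/measurable_EFinP; exact: measurable_indic.
- by move=> x _; rewrite lee_fin fE.
Qed.

(** * Cubes, Euclidean balls and their volumes *)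

Section cubes_and_balls.
Context {R : realType} {n : nat}.
Local Open Scope classical_set_scope.
Local Notation mu := (@lebesgue_Rn R n).
Implicit Types (v x y : Rn R n) (a : 'I_n -> R) (c r : R).

Definition cube a c : set (Rn R n) :=
  [set y | forall i, a i <= tnth y i <= a i + c].

Lemma measurable_cube a c : measurable (cube a c).
Proof.
rewrite (_ : cube a c = \bigcap_(i in [set: 'I_n])
    ((fun y : Rn R n => tnth y i) @^-1` `[a i, a i + c])); last first.
  by apply/seteqP; split=> y /= ay i; have /= := ay i; rewrite in_itv/=; auto.
apply: fin_bigcap_measurable => [|i _]; first exact: finite_finset.
by rewrite -[X in measurable X]setTI; apply: measurable_tnth.
Qed.

Lemma lebesgue_Rn_cube a c : 0 <= c -> mu (cube a c) = (c ^+ n)%:E.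
Proof.
move=> c0.
pose A i : set (measurableTypeR R) := `[a i, a i + c]%classic.
have mA i : measurable (A i) by exact: measurable_itv.
rewrite (_ : cube a c = [set x : Rn R n | forall i, A i (tnth x i)]).
  rewrite lebesgue_Rn_box//.
  transitivity (\prod_(i < n) (c%:E : \bar R))%E; last first.
    by rewrite prodEFin big_const_ord iter_mulr_1.
  apply: eq_bigr => i _; rewrite lebesgue_measure_itv/= lte_fin ltrDl.
  have [|c_le0] := ltP 0 c; first by rewrite -EFinB addrAC subrr add0r.
  by congr EFin; apply/eqP; rewrite eq_le c0.
by apply/seteqP; split=> y ay i; have := ay i; rewrite /A/= in_itv.
Qed.

Lemma euclid_ball_coord x y r i :
  euclid_ball x r y -> `|tnth y i - tnth x i| < r.
Proof.
apply: le_lt_trans; rewrite -sqrtr_sqr ler_wsqrtr//.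
by rewrite (bigD1 i)//= lerDl sumr_ge0// => j _; exact: sqr_ge0.
Qed.

Lemma measurable_euclid_ball x r : measurable (euclid_ball x r).
Proof.
rewrite -[X in measurable X]setTI.
rewrite (_ : euclid_ball x r = (fun y : Rn R n =>
  Num.sqrt (\sum_(i < n) (tnth y i - tnth x i) ^+ 2)) @^-1` `]-oo, r[);
  last first.
  by apply/seteqP; split => y; rewrite /= in_itv.
suff : measurable_fun setT (fun y : Rn R n =>
    Num.sqrt (\sum_(i < n) (tnth y i - tnth x i) ^+ 2)).
  by apply => //; exact: measurable_itv.
apply: measurableT_comp.
  by apply: continuous_measurable_fun; exact: sqrt_continuous.
apply: measurable_sum => i; apply: measurable_funX.
by apply: measurable_funB => //; exact: measurable_tnth.
Qed.

Lemma lebesgue_Rn_euclid_ball_le x r : 0 < r ->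
  (mu (euclid_ball x r) <= ((2 * r) ^+ n)%:E)%E.
Proof.
move=> r0; rewrite -(lebesgue_Rn_cube (fun i => tnth x i - r)); last lra.
apply: le_measure; rewrite ?inE; [exact: measurable_euclid_ball|
  exact: measurable_cube|].
move=> y /euclid_ball_coord xy i; have := xy i.
by rewrite ltr_distl => /andP[? ?]; apply/andP; split; lra.
Qed.

Lemma translate_euclid_ball v x r :
  euclid_ball x r =
  translate v @^-1` euclid_ball (translate v x) r.
Proof.
apply/seteqP; split=> y; rewrite /euclid_ball/= => yr.
  apply: le_lt_trans yr; rewrite ler_wsqrtr// ler_sum// => i _.
  by rewrite !tnth_mktuple opprD addrACA subrr addr0.
apply: le_lt_trans yr; rewrite ler_wsqrtr// ler_sum// => i _.
by rewrite !tnth_mktuple opprD addrACA subrr addr0.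
Qed.

(** Squared distances to the origin are at most n / (2n)^2 = 1 / (4n) < 1. This bounds the volume of
    the unit ball from below. *)
Lemma cube_sub_euclid_ball : (0 < n)%N ->
  cube (fun=> 0) (2 * n%:R)^-1 `<=` euclid_ball [tuple 0 | i < n] 1.
Proof.
move=> n0 y y01; rewrite /euclid_ball/=.
have n0' : (0 : R) < n%:R by rewrite ltr0n.
have n1 : (1 : R) <= n%:R by rewrite ler1n.
rewrite -[ltRHS]sqrtr1 ltr_sqrt//.
apply: (@le_lt_trans _ _ (\sum_(i < n) (2 * n%:R)^-1 ^+ 2)).
  apply: ler_sum => i _; rewrite tnth_mktuple subr0.
  by have := y01 i; rewrite add0r => /andP[? ?]; rewrite lerXn2r// nnegrE; lra.
rewrite sumr_const card_ord -[_ *+ n]mulr_natl.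
have -> : n%:R * (2 * n%:R)^-1 ^+ 2 = n%:R^-1 / 4 :> R by field; lra.
have : n%:R^-1 <= 1 :> R by rewrite invf_le1.
lra.
Qed.

End cubes_and_balls.

(** * A lower bound for the Fourier transform of a small cube *)

Section fourier_cube.
Context {R : realType} {n : nat}.
Local Open Scope classical_set_scope.
Local Notation mu := (@lebesgue_Rn R n).
Context (n0 : (0 < n)%N).

(** The cube D of the construction. For [x] in it and [y] in the unit ball, the inner product is at
    most n / (8n) = 1/8 in absolute value, which keeps the phase within [-1, 1]. *)
Definition small_cube : set (Rn R n) := cube (fun=> 0) (8 * n%:R)^-1.

Let nR0 : (0 : R) < n%:R. Proof. by rewrite ltr0n. Qed.

Let c0 : 0 < (8 * n%:R)^-1 :> R.
Proof. by rewrite invr_gt0 mulr_gt0. Qed.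

Lemma cos1_le (t : R) : `|t| <= 1 -> cos 1 <= cos t.
Proof.
move=> t1; rewrite -(cos_norm t) leNgt ltr_cos ?in_itv/= -?leNgt//.
  by have := @pi_ge2 R; lra.
by rewrite normr_ge0/=; have := @pi_ge2 R; lra.
Qed.

Lemma phase_small_cube (x y : Rn R n) : small_cube x ->
  euclid_ball [tuple 0 | i < n] 1 y -> `|phase x y| <= 1.
Proof.
move=> xD yB; rewrite /phase normrN normrM /dotp.
have s : `|\sum_(i < n) tnth x i * tnth y i| <= 8^-1.
  rewrite (_ : 8^-1 = \sum_(i < n) (8 * n%:R)^-1); last first.
    by rewrite sumr_const card_ord -[_ *+ n]mulr_natl; field; rewrite lt0r_neq0.
  apply: le_trans (ler_norm_sum _ _ _) _; apply: ler_sum => i _.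
  rewrite normrM -[leRHS]mulr1; apply: ler_pM => //.
    by have := xD i; rewrite add0r => /andP[? ?]; rewrite ger0_norm.
  by have := euclid_ball_coord i yB; rewrite tnth_mktuple subr0 => /ltW.
have p0 := @pi_gt0 R.
(* This crude bound suffices: 2 pi < 8 against the factor 1/8. *)
have p2 : pi < 4 :> R by have := @pihalf_lt2 R; lra.
rewrite ger0_norm; last lra.
apply: (@le_trans _ _ (8 * 8^-1)); last by lra.
by apply: ler_pM => //; lra.
Qed.

(** On the cube the phase is at most 1 in absolute value, so the cosine is at least [cos 1]; the
    other factor is the volume of the cube. The real part alone thus bounds the transform from
    below. *)
Lemma fcos_small_cube (y : Rn R n) : euclid_ball [tuple 0 | i < n] 1 y ->
  cos 1 * (8 * n%:R)^-1 ^+ n <= fcos \1_small_cube y.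
Proof.
move=> yB; have mD : measurable small_cube by exact: measurable_cube.
have iD : mu.-integrable setT (EFin \o (\1_small_cube : Rn R n -> R)).
  apply: (integrable_le_indic (E := small_cube)) => //.
    by rewrite [X in (X < _)%E]lebesgue_Rn_cube ?ltry// ltW.
  by move=> x; rewrite ger0_norm// indicE ler0n.
rewrite (_ : _ * _ = \int[mu]_x (\1_small_cube x * cos 1)); last first.
  rewrite RintegralZr// mulrC; congr (_ * _).
  rewrite /Rintegral integral_indic// setIT.
  by rewrite [X in fine X]lebesgue_Rn_cube ?ltW.
apply: le_Rintegral => //.
- by apply: integrable_mul_bounded => // x; rewrite ler_norml cos_geN1 cos_le1.
- exact: integrable_mul_cos.
move=> x _; rewrite indicE; case: (boolP (x \in small_cube)) => xD /=.
  by rewrite !mul1r cos1_le// phase_small_cube//; exact: set_mem.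
by rewrite !mul0r.
Qed.

End fourier_cube.

(** * Sparse sets and the Rudin-Shapiro recursion *)

Section rudin_shapiro.
Context {R : realType} {n : nat}.
Local Open Scope classical_set_scope.
Local Notation mu := (@lebesgue_Rn R n).
Context (i0 : 'I_n) (d : R) (d_gt0 : 0 < d).

(* [2 ^+ n * r ^+ n] is the volume of the cube circumscribed to the ball: with
   this constant the bound is trivial for [r <= 1], as [d <= n]. *)
Definition sparse (E : set (Rn R n)) := forall (x : Rn R n) (r : R), 0 < r ->
  (mu (E `&` euclid_ball x r) <= (2 ^+ n * r `^ d)%:E)%E.

Definition dominated (E : set (Rn R n)) (f : Rn R n -> R) :=
  measurable_fun setT f /\ forall x, `|f x| <= \1_E x.

(** For [r <= 1] the ball itself has volume at most (2r)^n; for larger [r] the cube has volume at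
    most 1. *)
Lemma sparse_small_cube : d <= n%:R -> sparse small_cube.
Proof.
move=> dn x r r0.
have n0 : (0 < n)%N by exact: leq_ltn_trans (ltn_ord i0).
have mB := measurable_euclid_ball x r.
have mD : measurable (small_cube : set (Rn R n)) by exact: measurable_cube.
have p1 : 1 <= 2 ^+ n :> R by rewrite exprn_ege1// ler1n.
have [r1|/ltW r1] := leP r 1.
  apply: (@le_trans _ _ (mu (euclid_ball x r))).
    by apply: le_measure; rewrite ?inE//; exact: measurableI.
  apply: (le_trans (lebesgue_Rn_euclid_ball_le x r0)).
  rewrite lee_fin exprMn ler_wpM2l ?exprn_ge0//.
  by rewrite -powR_mulrn ?(ltW r0)// ger_powR// r0.
apply: (@le_trans _ _ (mu (small_cube : set (Rn R n)))).
  by apply: le_measure; rewrite ?inE//; exact: measurableI.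
have n1 : (1 : R) <= n%:R by rewrite ler1n.
rewrite [leLHS]lebesgue_Rn_cube ?invr_ge0 ?mulr_ge0// lee_fin.
apply: (@le_trans _ _ 1).
  by rewrite exprn_ile1// ?invr_ge0 ?mulr_ge0// invf_le1; lra.
rewrite -[leLHS]mulr1 ler_pM// -(powRr0 r) ler_powR// ltW//.
Qed.

(* The two copies of [E] are so far apart that a ball meeting both of them has
   radius [r] with [r `^ d >= 2 ^ k.+1]. *)
Lemma sparse_doubling (E : set (Rn R n)) (l : R) k (v : Rn R n) :
  measurable E -> (mu E <= (2 ^+ k)%:E)%E ->
  (forall x, E x -> 0 <= tnth x i0 <= l) -> sparse E ->
  tnth v i0 = l + 2 * (2 ^+ k.+1) `^ d^-1 ->
  sparse (E `|` translate (map_tuple -%R v) @^-1` E).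
Proof.
move=> mE Ek El sE vm x r r0.
set w := map_tuple _ _; set F := _ @^-1` _.
have mF : measurable F.
  by rewrite -[X in measurable X]setTI; exact: measurable_translate.
have mB := measurable_euclid_ball x r.
set t := _ `^ _ in vm.
(* In coordinate [i0] the two copies are at least [2 * t] apart, while points of the ball differ by
   less than [2 * r]. Hence for [r <= t] the ball meets at most one copy, and the sparsity of [E],
   translated if necessary, is enough. *)
have [rt|tr] := leP r t.
  have [EB0|/set0P[y [Ey yB]]] := eqVneq (E `&` euclid_ball x r) set0.
    rewrite setIUl EB0 set0U (translate_euclid_ball w x r).
    rewrite -preimage_setI lebesgue_Rn_translate; first exact: sE.
    by apply: measurableI => //; exact: measurable_euclid_ball.
  rewrite setIUl (_ : F `&` _ = set0) ?setU0; first exact: sE.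
  rewrite -subset0 => z [Fz zB].
  have := El _ Fz; have := El _ Ey.
  have := euclid_ball_coord i0 yB; have := euclid_ball_coord i0 zB.
  rewrite !ltr_distl tnth_mktuple tnth_map vm.
  by move=> {Ek} /andP[? ?] /andP[? ?] /andP[? ?] /andP[? ?]; lra.
have p1 : 1 <= 2 ^+ n :> R by rewrite exprn_ege1// ler1n.
apply: (@le_trans _ _ (mu E + mu F)%E).
  apply: (@le_trans _ _ (mu (E `|` F))).
    apply: le_measure; rewrite ?inE//; first apply: measurableI => //.
      exact: measurableU.
    exact: measurableU.
  exact: measureU2.
rewrite [X in (_ + X)%E]lebesgue_Rn_translate//.
apply: (@le_trans _ _ (2 ^+ k + 2 ^+ k)%:E); first by rewrite EFinD leeD.
rewrite lee_fin -mulr2n -[_ ^+ k *+ 2]mulr_natl -exprS.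
apply: (@le_trans _ _ (r `^ d)); last by rewrite ler_peMl// powR_ge0.
have -> : 2 ^+ k.+1 = t `^ d :> R.
  by rewrite -powRrM mulVf ?gt_eqF// powRr1// exprn_ge0.
by apply: ge0_ler_powR; rewrite ?nnegrE ?powR_ge0 ?ltW.
Qed.

(** Induction on [k], with one set [E] dominating both functions. The extent [l] of [E] in
    coordinate [i0] is carried along because it determines the length of the next translation. *)
Lemma rudin_shapiro k : d <= n%:R -> exists f g E (l : R),
  [/\ measurable E, (mu E <= (2 ^+ k)%:E)%E, 0 <= l,
      (forall x, E x -> 0 <= tnth x i0 <= l) & sparse E] /\
  [/\ dominated E f, dominated E g &
      forall y, (fcos f y ^+ 2 + fsin f y ^+ 2) +
                (fcos g y ^+ 2 + fsin g y ^+ 2) =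
        2 ^+ k.+1 * (fcos \1_small_cube y ^+ 2 + fsin \1_small_cube y ^+ 2)].
Proof.
move=> dn; have n0 : (0 < n)%N by exact: leq_ltn_trans (ltn_ord i0).
elim: k => [|k [f [g [E [l [[mE Ek l0 El sE] [[mf fE] [mg gE] fg]]]]]]].
  have c0 : 0 <= (8 * n%:R)^-1 :> R by rewrite invr_ge0 mulr_ge0.
  have mD : measurable (small_cube : set (Rn R n)) by exact: measurable_cube.
  exists \1_small_cube, \1_small_cube, small_cube, (8 * n%:R)^-1.
  split; split=> //.
  - have n1 : (1 : R) <= n%:R by rewrite ler1n.
    rewrite [leLHS]lebesgue_Rn_cube// lee_fin expr0 exprn_ile1//.
    by rewrite invf_le1; lra.
  - by move=> x /(_ i0); rewrite add0r.
  - exact: sparse_small_cube.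
  - by split=> [|x]; [exact: measurable_indic|rewrite ger0_norm// indicE].
  - by split=> [|x]; [exact: measurable_indic|rewrite ger0_norm// indicE].
  - by move=> y; rewrite expr1 mulr_natl mulr2n.
(* The displacement required by [sparse_doubling]; it also exceeds [l], which makes [E] and its
   translate disjoint. *)
pose m := l + 2 * (2 ^+ k.+1) `^ d^-1.
have lm : l < m by rewrite ltrDl mulr_gt0// powR_gt0// exprn_gt0.
pose v : Rn R n := [tuple m | i < n].
have vm : tnth v i0 = m by rewrite tnth_mktuple.
set w := map_tuple -%R v; pose F := translate w @^-1` E.
have mF : measurable F.
  by rewrite -[X in measurable X]setTI; exact: measurable_translate.
have Eoo : (mu E < +oo)%E by rewrite (le_lt_trans Ek)// ltry.
have fi := integrable_le_indic mE Eoo mf fE.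
have gi := integrable_le_indic mE Eoo mg gE.
pose h := g \o translate w.
have mh : measurable_fun setT h.
  by apply: measurableT_comp => //; exact: measurable_translate.
have hF x : `|h x| <= \1_F x by exact: gE.
have Fm x : F x -> m <= tnth x i0 <= m + l.
  move=> /El; rewrite tnth_mktuple tnth_map vm => /andP[? ?].
  by apply/andP; clear Ek Eoo; split; lra.
(* Since [E] and [F] are disjoint, at most one of [f x] and [h x] is nonzero, so both the sum and
   the difference remain bounded by the indicator of the union. *)
have fhE x : `|f x| + `|h x| <= \1_(E `|` F) x.
  have := fE x; have := hF x; rewrite !indicE in_setU.
  case: (boolP (x \in E)) => [/set_mem Ex|_]; last first.
    by move=> ? ?; rewrite -[leRHS]add0r lerD.
  case: (boolP (x \in F)) => [/set_mem Fx|_ ? ?]; last first.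
    by rewrite -[leRHS]addr0 lerD.
  have /andP[_ ?] := El _ Ex; have /andP[? _] := Fm _ Fx.
  by exfalso; clear Ek Eoo; lra.
exists (f \+ h), (f \- h), (E `|` F), (m + l); split; split.
- exact: measurableU.
- apply: (@le_trans _ _ (mu E + mu F)%E); first exact: measureU2.
  rewrite [X in (_ + X)%E]lebesgue_Rn_translate//.
  apply: (@le_trans _ _ (2 ^+ k + 2 ^+ k)%:E); first by rewrite EFinD leeD.
  by rewrite lee_fin exprS mulr_natl mulr2n.
- by clear Ek Eoo; lra.
- by move=> x [/El|/Fm] /andP[? ?]; apply/andP; clear Ek Eoo; split; lra.
- exact: (sparse_doubling mE Ek El sE vm).
- split=> [|x]; first exact: measurable_funD.
  exact: le_trans (ler_normD _ _) (fhE x).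
- split=> [|x]; first exact: measurable_funB.
  exact: le_trans (ler_normB _ _) (fhE x).
- move=> y; rewrite (fourier_parallelogram v y fi gi) fg.
  by rewrite (exprS _ k.+1) -mulrA mulr_natl.
Qed.

End rudin_shapiro.

(** * Morrey norm bounds: from above by sparsity, from below by the unit ball *)

Section morrey.
Context {R : realType} {n : nat}.
Local Open Scope classical_set_scope.
Local Notation mu := (@lebesgue_Rn R n).
Implicit Types (f : Rn R n -> R) (E : set (Rn R n)).

Lemma normc_real (a : R) : Normc.normc a%:C = `|a|.
Proof. by rewrite /= expr0n addr0 sqrtr_sqr. Qed.

Lemma measurable_normc_real f : measurable_fun setT f ->
  measurable_fun setT (fun x => Normc.normc (f x)%:C).
Proof.
move=> mf; rewrite (_ : (fun x => _) = (fun x => `|f x|)).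
  exact: measurableT_comp.
by apply/funext => x; exact: normc_real.
Qed.

Lemma measurable_Lp_integrand (q : R) (B : set (Rn R n)) (u : Rn R n -> R[i]) :
  measurable B -> measurable_fun setT (fun x => Normc.normc (u x)) ->
  measurable_fun setT (fun x =>
    (`|((fun x => (Normc.normc (u x))%:E) \_ B) x| `^ q)%E).
Proof.
move=> mB mu_.
apply: (@measurableT_comp _ _ _ _ _ _ (fun x => poweR x q)) => //.
  exact: measurable_poweR.
apply: measurableT_comp => //.
by apply/(measurable_restrictT _ mB)/measurable_EFinP; exact: measurable_funTS.
Qed.

(** As [|f|] is at most 1 on [E] and vanishes elsewhere, its p-th power is also bounded by the
    indicator of [E]. *)
Lemma Lp_norm_dominated (p : R) (E B : set (Rn R n)) f :
  0 < p -> measurable E -> measurable B -> dominated E f ->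
  (Lp_norm p B (fun x => (f x)%:C) <= mu (E `&` B) `^ p^-1)%E.
Proof.
move=> p0 mE mB [mf fE]; rewrite /Lp_norm unlock.
have mEB : measurable (E `&` B) by exact: measurableI.
apply: gt0_ler_poweR.
- by rewrite invr_ge0 ltW.
- rewrite in_itv/= leey andbT integral_ge0// => x _; exact: poweR_ge0.
- by rewrite in_itv/= leey andbT measure_ge0.
rewrite -[E `&` B]setIT -integral_indic//.
apply: ge0_le_integral => //.
- by move=> x _; exact: poweR_ge0.
- by apply: measurable_Lp_integrand => //; exact: measurable_normc_real.
- by apply/measurable_EFinP; exact: measurable_indic.
move=> x _; rewrite indicE in_setI patchE.
case: (boolP (x \in B)) => _; rewrite ?andbF ?andbT.
  rewrite normc_real /= normr_id lee_fin.
  have := fE x; rewrite indicE; case: (x \in E) => fx /=.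
    apply: (@le_trans _ _ (1 `^ p)); last by rewrite powR1.
    by apply: ge0_ler_powR; rewrite ?nnegrE// ltW.
  have /eqP -> : `|f x| == 0 by rewrite eq_le fx normr_ge0.
  by rewrite powR0// gt_eqF.
by rewrite abse0 poweR_EFin powR0// gt_eqF.
Qed.

(** Sparsity with exponent [lambda * p] is what produces Morrey growth: the p-th root of [r]^
    (lambda * p)[is]r [^ lambda]. *)
Lemma Lp_norm_sparse (p lambda : R) E f (x : Rn R n) (r : R) :
  0 < p -> measurable E -> sparse (lambda * p) E -> dominated E f -> 0 < r ->
  (Lp_norm p (euclid_ball x r) (fun x => (f x)%:C) <=
    ((2 ^+ n) `^ p^-1 * r `^ lambda)%:E)%E.
Proof.
move=> p0 mE sE fE r0; have mB := measurable_euclid_ball x r.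
apply: (le_trans (Lp_norm_dominated p0 mE mB fE)).
have -> : (2 ^+ n) `^ p^-1 * r `^ lambda =
          (2 ^+ n * r `^ (lambda * p)) `^ p^-1.
  by rewrite powRM ?exprn_ge0 ?powR_ge0// -powRrM mulfK// gt_eqF.
rewrite -poweR_EFin; apply: gt0_ler_poweR.
- by rewrite invr_ge0 ltW.
- by rewrite in_itv/= leey andbT measure_ge0.
- by rewrite in_itv/= leey andbT lee_fin mulr_ge0 ?exprn_ge0 ?powR_ge0.
- exact: sE.
Qed.

(** The bound depends only on [n] and [p], so it is uniform along the Rudin-Shapiro recursion. *)
Lemma morrey_norm_sparse (p lambda : R) E f :
  0 < p -> measurable E -> sparse (lambda * p) E -> dominated E f ->
  (morrey_norm p lambda (fun x => (f x)%:C) <= ((2 ^+ n) `^ p^-1)%:E)%E.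
Proof.
move=> p0 mE sE fE; apply/ereal_supP => _ [r /= r0 <-].
rewrite powRN lee_pdivrMl ?powR_gt0//.
apply/ereal_supP => _ [x _ <-]; rewrite -EFinM mulrC.
exact: (Lp_norm_sparse (E := E)).
Qed.

Lemma morrey_sparse (p lambda : R) E f :
  0 < p -> measurable E -> sparse (lambda * p) E -> dominated E f ->
  morrey p lambda (fun x => (f x)%:C).
Proof.
move=> p0 mE sE fE; have [mf _] := fE; split; last first.
  by apply: (le_lt_trans (morrey_norm_sparse p0 mE sE fE)); rewrite ltry.
split; first by split => //=; exact: measurable_cst.
move=> x r r0.
by apply: (le_lt_trans (Lp_norm_sparse x p0 mE sE fE r0)); rewrite ltry.
Qed.

Lemma L1_dominated E f : measurable E -> (mu E < +oo)%E -> dominated E f ->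
  L1 (fun x => (f x)%:C).
Proof.
move=> mE Eoo [mf fE]; split; first by split => //=; exact: measurable_cst.
apply: (integrable_le_indic mE Eoo (measurable_normc_real mf)) => x.
by rewrite normc_real normr_id.
Qed.

Lemma measurable_normc_fourier f : measurable_fun setT f ->
  measurable_fun setT (fun y => Normc.normc (fourier (fun x => (f x)%:C) y)).
Proof.
move=> mf.
rewrite (_ : (fun y => _) =
    (fun y => Num.sqrt (fcos f y ^+ 2 + fsin f y ^+ 2))); last first.
  by apply/funext => y; rewrite fourier_real.
apply: measurableT_comp.
  by apply: continuous_measurable_fun; exact: sqrt_continuous.
apply: measurable_funD; apply: measurable_funX.
  exact: measurable_fcos.
exact: measurable_fsin.
Qed.

Lemma Lp_norm_unit_ball_le_morrey_norm (q nu : R) (u : Rn R n -> R[i])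
    (x : Rn R n) :
  (Lp_norm q (euclid_ball x 1) u <= morrey_norm q nu u)%E.
Proof.
apply: le_ereal_sup_tmp; exists ((1 `^ (- nu))%:E *
  ereal_sup [set Lp_norm q (euclid_ball x 1) u | x in [set: Rn R n]])%E.
  by exists 1 => //=.
by rewrite powR1 mul1e; apply: ereal_sup_ubound; exists x.
Qed.

Lemma morrey_norm_ge0 (q nu : R) (u : Rn R n -> R[i]) :
  (0 <= morrey_norm q nu u)%E.
Proof.
apply: le_trans (Lp_norm_unit_ball_le_morrey_norm q nu u [tuple 0 | i < n]).
exact: Lnorm_ge0.
Qed.

(** On [B] the sum of the q-th powers of the two moduli is at least [s]^
    q[; integrating it over]B[gives at most twice]K [^ q]. *)
Lemma max_Lp_norm_ge (q s K : R) (B : set (Rn R n)) (u w : Rn R n -> R[i]) :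
  0 < q -> 0 <= s -> measurable B ->
  measurable_fun setT (fun x => Normc.normc (u x)) ->
  measurable_fun setT (fun x => Normc.normc (w x)) ->
  (forall x, B x -> s <= Num.max (Normc.normc (u x)) (Normc.normc (w x))) ->
  (Lp_norm q B u <= K%:E)%E -> (Lp_norm q B w <= K%:E)%E ->
  ((s `^ q)%:E * mu B <= (K `^ q *+ 2)%:E)%E.
Proof.
move=> q0 s0 mB mu_ mw sB uK wK.
have K0 : 0 <= K by rewrite -lee_fin (le_trans _ uK)// Lnorm_ge0.
have LK (z : Rn R n -> R[i]) : (Lp_norm q B z <= K%:E)%E ->
    (\int[mu]_x (`|((fun x => (Normc.normc (z x))%:E) \_ B) x| `^ q)
      <= (K `^ q)%:E)%E.
  move=> zK; rewrite -poweR_Lnorm ?gt_eqF// -poweR_EFin.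
  apply: gt0_ler_poweR => //; rewrite ?ltW// in_itv/= leey andbT.
    exact: Lnorm_ge0.
  by rewrite lee_fin.
rewrite mulr2n EFinD; apply: le_trans (leeD (LK _ uK) (LK _ wK)).
rewrite -ge0_integralD//; [|by move=> x _; exact: poweR_ge0|
  exact: measurable_Lp_integrand|by move=> x _; exact: poweR_ge0|
  exact: measurable_Lp_integrand].
rewrite -[B in leLHS]setIT -integral_indic// -ge0_integralZl//; last 2 first.
- by apply/measurable_EFinP; exact: measurable_indic.
- by rewrite lee_fin powR_ge0.
apply: ge0_le_integral => //.
- by move=> x _; rewrite -EFinM lee_fin mulr_ge0// ?powR_ge0// indicE.
- by apply: measurable_funeM; apply/measurable_EFinP; exact: measurable_indic.
- by apply: emeasurable_funD; exact: measurable_Lp_integrand.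
move=> x _; rewrite indicE !patchE.
case: (boolP (x \in B)) => [/set_mem Bx|_] /=; last first.
  by rewrite mule0 adde_ge0// poweR_ge0.
rewrite mule1 -EFinD lee_fin.
have nn (z : R[i]) : 0 <= Normc.normc z by case: z => a b /=; exact: sqrtr_ge0.
rewrite !ger0_norm//; have := sB _ Bx; rewrite le_max => /orP[h|h].
  by rewrite -[leLHS]addr0 lerD ?powR_ge0// ge0_ler_powR ?nnegrE// ltW.
by rewrite -[leLHS]add0r lerD ?powR_ge0// ge0_ler_powR ?nnegrE// ltW.
Qed.

End morrey.

(** * The contradiction with a uniform bound *)

Theorem theoremA1 (R : realType) (n : nat) (p q nu lambda : R) :
  (1 <= n)%N -> 1 <= p -> 1 <= q ->
  0 <= nu <= n%:R / q -> 0 < lambda <= n%:R / p ->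
  ~ exists C : R, forall f : Rn R n -> R[i],
      morrey p lambda f -> L1 f ->
      (morrey_norm q nu (fourier f) <= C%:E * morrey_norm p lambda f)%E.
Proof.
move=> n0 p1 q1 _ /andP[l0 lnp] [C HC].
have p0 : 0 < p by lra.
have q0 : 0 < q by lra.
have d0 : 0 < lambda * p by rewrite mulr_gt0.
have dn : lambda * p <= n%:R by rewrite -ler_pdivlMr.
have nR0 : (0 : R) < n%:R by rewrite ltr0n.
pose B : set (Rn R n) := euclid_ball [tuple 0 | i < n] 1.
(* The bound that [C] would force on the L_q norms over [B] of all the transforms. The absolute
   value covers a negative [C]. *)
pose K := `|C| * (2 ^+ n) `^ p^-1.
pose c : R := cos 1 * (8 * n%:R)^-1 ^+ n.
have c0 : 0 < c by rewrite mulr_gt0 ?cos1_gt0 ?exprn_gt0 ?invr_gt0 ?mulr_gt0.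
pose b : R := (2 * n%:R)^-1 ^+ n.
have b0 : 0 < b by rewrite exprn_gt0 ?invr_gt0 ?mulr_gt0.
have mB : measurable B by exact: measurable_euclid_ball.
have bB : (b%:E <= lebesgue_Rn n B)%E.
  rewrite -(lebesgue_Rn_cube (fun=> 0)) ?invr_ge0 ?mulr_ge0//.
  apply: le_measure; rewrite ?inE//; first exact: measurable_cube.
  exact: cube_sub_euclid_ball.
have K0 : 0 <= K `^ q by exact: powR_ge0.
pose a := (K `^ q *+ 2 / b + 1) / c.
pose j := Num.bound a.
have ja : a < 2 ^+ j by exact: upper_nthrootP.
(* The even index [2 * j] makes [2 ^+ (2 * j)] the square of [2 ^+ j]. *)
have [f [g [E [l [[mE E2 _ _ sE] [fE gE fg]]]]]] :=
  rudin_shapiro (Ordinal n0) d0 (2 * j) dn.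
have Eoo : (lebesgue_Rn n E < +oo)%E by rewrite (le_lt_trans E2)// ltry.
have bound h : dominated E h ->
    (Lp_norm q B (fourier (fun x => (h x)%:C)) <= K%:E)%E.
  move=> hE; apply: le_trans (Lp_norm_unit_ball_le_morrey_norm q nu _ _) _.
  apply: (le_trans (HC _ (morrey_sparse p0 mE sE hE) (L1_dominated mE Eoo hE))).
  apply: (@le_trans _ _ (`|C|%:E * morrey_norm p lambda (fun x => (h x)%:C))%E).
    by rewrite lee_wpmul2r ?morrey_norm_ge0// lee_fin ler_norm.
  by rewrite EFinM lee_wpmul2l ?lee_fin// (morrey_norm_sparse p0 mE sE hE).
have s0 : 0 <= 2 ^+ j * c by rewrite mulr_ge0 ?exprn_ge0// ltW.
(* If both moduli were smaller, their squares would sum to less than [2 ^+ (2 * j).+1 * c ^+ 2],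
   against the identity [fg] and the lower bound [c] for the transform of the cube. *)
have large y : B y -> 2 ^+ j * c <=
    Num.max (Normc.normc (fourier (fun x => (f x)%:C) y))
            (Normc.normc (fourier (fun x => (g x)%:C) y)).
  move=> By; rewrite leNgt gt_max !fourier_real /=.
  set u := fcos f y ^+ 2 + _; set w := fcos g y ^+ 2 + _.
  apply/negP => /andP[us ws].
  have sq (z : R) : 0 <= z -> Num.sqrt z < 2 ^+ j * c -> z < (2 ^+ j * c) ^+ 2.
    by move=> z0 zs; rewrite -[ltLHS]sqr_sqrtr// ltrXn2r// nnegrE sqrtr_ge0.
  have {}us : u < (2 ^+ j * c) ^+ 2 by rewrite sq// addr_ge0// sqr_ge0.
  have {}ws : w < (2 ^+ j * c) ^+ 2 by rewrite sq// addr_ge0// sqr_ge0.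
  have : u + w < 2 ^+ (2 * j).+1 * c ^+ 2.
    by rewrite exprS mulnC exprM -mulrA -exprMn mulr_natl mulr2n ltrD.
  rewrite fg ltr_pM2l ?exprn_gt0//; apply/negP; rewrite -leNgt.
  rewrite -[leLHS]addr0 lerD ?sqr_ge0//.
  have cf : c <= fcos \1_small_cube y by exact: fcos_small_cube.
  by rewrite lerXn2r// nnegrE ltW// (lt_le_trans c0).
have mf := measurable_normc_fourier fE.1.
have mg := measurable_normc_fourier gE.1.
have := max_Lp_norm_ge q0 s0 mB mf mg large (bound f fE) (bound g gE).
apply/negP; rewrite -ltNge.
(* By the choice of [j], [(2 ^+ j * c)]^ q * b >= 2 ^+ j * c * b > K [^ q *+ 2], which contradicts
   the upper bound. *)
apply: (@lt_le_trans _ _ (((2 ^+ j * c) `^ q)%:E * b%:E)%E); last first.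
  by rewrite lee_wpmul2l// lee_fin powR_ge0.
rewrite -EFinM lte_fin -ltr_pdivrMr//.
have s1 : K `^ q *+ 2 / b + 1 < 2 ^+ j * c by rewrite -ltr_pdivrMr.
have Kb : 0 <= K `^ q *+ 2 / b by rewrite divr_ge0 ?mulrn_wge0// ltW.
apply: (@lt_le_trans _ _ (2 ^+ j * c)).
  by apply: lt_trans s1; rewrite ltrDl.
rewrite -[leLHS]powRr1// ler_powR//.
by apply: le_trans (ltW s1); rewrite lerDr.
Qed.
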